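(* Let $K$ be a field, $A=K[x_1,\ldots,x_n]$ and $B=K[y_1,\ldots,y_m]$ polynomial rings in disjoint sets of variables, and $S=A\otimes_K B=K[x_1,\ldots,x_n,y_1,\ldots,y_m]$. Let $k\ge1$ and let $I\subset A$ and $J\subset B$ be two proper monomial ideals such that $$\overline{(I+J)^k}=\sum_{i+j=k}\overline{I^i}\;\overline{J^j}.$$ If $\mathfrak{p}\subset A$ and $\mathfrak{q}\subset B$ are two monomial prime ideals such that $\mathfrak{p}+\mathfrak{q}\in\mathrm{Ass}(\overline{(I+J)^k})$, then $$\mathrm{v}_{\mathfrak{p}+\mathfrak{q}}(\overline{(I+J)^k})=\min_{\substack{0\le d<k\\ \mathfrak{p}\in\mathrm{Ass}(\overline{I^{k-d}})\\ \mathfrak{q}\in\mathrm{Ass}(\overline{J^{d+1}})}}\bigl(\mathrm{v}_{\mathfrak{p}}(\overline{I^{k-d}})+\mathrm{v}_{\mathfrak{q}}(\overline{J^{d+1}})\bigr),$$ where the minimum is over all integers $d$ satisfying the displayed conditions.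
   Context: All polynomial rings carry the standard grading. Let $R=\bigoplus_{d\ge0}R_d$ be a standard graded polynomial ring over $K$ and $L\subset R$ a proper graded ideal; $\mathrm{Ass}(L)$ denotes the set of associated primes of $L$ (i.e. of $R/L$). For $f\in R$, $L:f=\{u\in R\mid uf\in L\}$. For $\mathfrak{p}\in\mathrm{Ass}(L)$ the local $\mathrm{v}$-number is $\mathrm{v}_{\mathfrak{p}}(L)=\min\{d\ge 0\mid \exists f\in R_d \text{ with } L:f=\mathfrak{p}\}$. A monomial ideal is an ideal generated by monomials; a monomial prime ideal is a prime ideal that is a monomial ideal. The integral closure $\overline{L}$ of an ideal $L\subset R$ is the set of all $f\in R$ for which there exist an integer $n\ge1$ and $r_i\in L^i$ ($1\le i\le n$) with $f^n+r_1f^{n-1}+\cdots+r_{n-1}f+r_n=0$. The zeroth power of an ideal is the whole ring. For ideals $I'\subset A$ and $J'\subset B$, the sum $I'+J'$ means $I'S+J'S$ and the product $I'J'$ means $(I'S)(J'S)$, as ideals of $S$. The integral closures $\overline{I^i}$, $\overline{J^j}$, $\overline{(I+J)^k}$ are taken in $A$, $B$, $S$ respectively, and the sum in the hypothesis runs over integers $i,j\ge0$ with $i+j=k$.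
   Formalization: The ideals I and J are additionally assumed nonzero; with I = 0, J = (y), k = 2, p = 0, q = (y) the claimed formula fails, since the left side is 1 and the minimum on the right is 0. *)

(* Defs.v *)
From mathcomp Require Export all_boot all_algebra.
From mathcomp Require Export boolp classical_sets.
From mathcomp Require Export mpoly.

Set Implicit Arguments.
Unset Strict Implicit.
Unset Printing Implicit Defensive.

Import GRing.Theory.
Local Open Scope ring_scope.
Local Open Scope classical_set_scope.

Section Ideals.
Variable R : comNzRingType.
Implicit Types I J L P G : set R.

Definition is_ideal L : Prop :=
  [/\ L 0, forall u v, L u -> L v -> L (u + v) & forall a u, L u -> L (a * u)].

Definition ideal_span G : set R := smallest is_ideal G.

Definition ideal_add I J : set R := ideal_span (I `|` J).

Definition ideal_mul I J : set R := ideal_span [set u * v | u in I & v in J].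

(* I^0 is the whole ring, also for I = 0. *)
Definition ideal_pow I (k : nat) : set R := iter k (ideal_mul I) setT.

Definition ideal_bigsum (T : Type) (D : set T) (F : T -> set R) : set R :=
  ideal_span (\bigcup_(t in D) F t).

Definition integral_closure L : set R :=
  [set f | exists n (r : nat -> R),
    [/\ (0 < n)%N,
        forall i, (1 <= i <= n)%N -> ideal_pow L i (r i)
      & f ^+ n + \sum_(1 <= i < n.+1) r i * f ^+ (n - i) = 0]].

Definition colon L (f : R) : set R := [set u | L (u * f)].

Definition is_prime_ideal P : Prop :=
  [/\ is_ideal P, ~ P 1 & forall a b, P (a * b) -> P a \/ P b].

Definition Ass L : set (set R) :=
  [set P | is_prime_ideal P /\ exists f, colon L f = P].

End Ideals.

Definition is_min (E : set nat) (d : nat) : Prop :=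
  E d /\ forall e, E e -> (d <= e)%N.

Section Polynomial.
Variables (K : fieldType) (n : nat).
Implicit Types L P : set {mpoly K[n]}.

Definition is_monomial_ideal L : Prop :=
  exists M : set 'X_{1..n}, L = ideal_span [set 'X_[K, t] | t in M].

Definition is_monomial_prime P : Prop :=
  is_monomial_ideal P /\ is_prime_ideal P.

(* The local v-number; it is only meaningful when P is in Ass L. The value 0
   is taken if no homogeneous f satisfies L : f = P. *)
Definition vnumber P L : nat :=
  xget 0%N (is_min
    [set d | exists f : {mpoly K[n]}, f \is d.-homog /\ colon L f = P]).

End Polynomial.

(* With A = K[x_1..x_n], B = K[y_1..y_m] and S = K[x_1..x_n, y_1..y_m], the
   first n variables of S are the x_i and the last m are the y_j. *)
Section Extension.
Variables (K : fieldType) (n m : nat).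

Definition embl (f : {mpoly K[n]}) : {mpoly K[n + m]} :=
  f \mPo [tuple 'X_(lshift m i) | i < n].

Definition embr (g : {mpoly K[m]}) : {mpoly K[n + m]} :=
  g \mPo [tuple 'X_(rshift n j) | j < m].

Definition extl (I : set {mpoly K[n]}) : set {mpoly K[n + m]} :=
  ideal_span (embl @` I).

Definition extr (J : set {mpoly K[m]}) : set {mpoly K[n + m]} :=
  ideal_span (embr @` J).

Definition sum_ext I J : set {mpoly K[n + m]} := ideal_add (extl I) (extr J).

Definition prod_ext I J : set {mpoly K[n + m]} := ideal_mul (extl I) (extr J).

End Extension.

(* Main.v *)
From HB Require Import structures.
From mathcomp Require Import order mxpoly zify ring.
Require Import Defs.

(** Write [I_i] and [J_j] for the integral closures of [I ^ i] and [J ^ j]. The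
integral closure of a monomial ideal is a monomial ideal
([integral_closure_monset]), so by hypothesis the ideal [L], the sum of the
[I_i J_j] with [i + j = k], is one too. For a monomial ideal, every associated
prime is the colon by a monomial, and the local v-number is the least degree of
such a monomial ([colon_monset], [vnumber_monset]). Everything thus happens on
exponents, where a monomial of [S] is a pair [u v].

The link between the two factors is a cancellation property: if
[I_(i+1) : u = p] is prime, then [I] is contained in [p], hence [u I] in
[I_(i+1)], and therefore [u] lies in [I_i] ([clos_cancel],
[clos_upow_cancel]). So [u] lies in [I_i] and not in [I_(i+1)]; call [i] its
level. A pair [u v] lies in [L] when the levels of [u] and [v] add up to at
least [k].

Suppose that [L : u v = p + q] and let [d] be the level of [v]. Then [d < k],
and a multiple of [u], paired with [v], lies in [L] exactly when it lies in
[I_(k-d)]; this gives [I_(k-d) : u = p]. By cancellation the level of [u] is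
[k - d - 1], and symmetrically [J_(d+1) : v = q] ([mcolon_unpair]). Conversely,
if both equalities hold, cancellation gives the levels of [u] and [v], and
[L : u v = p + q] follows ([mcolon_pair]). Degrees are additive on pairs, so
minimizing over all monomials gives the formula.

That the closure of a monomial ideal is an ideal comes from the Rees algebra
([integral_closure_add]). That it is monomial comes from the powers of an
integral element [f]: up to a fixed factor, [f ^+ l] lies in the [l]-th power
of the ideal, which passes to leading monomials ([asymptotic_clos]), and for a
single monomial this asymptotic condition gives integrality by Dickson's lemma
([clos_asymptotic]). *)

Set Implicit Arguments.
Unset Strict Implicit.
Unset Printing Implicit Defensive.

Import GRing.Theory.
Local Open Scope ring_scope.
Local Open Scope classical_set_scope.

(** * Powers of ideals, the Rees algebra and integral closure *)

Section IdealPowers.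
Variable R : comNzRingType.
Implicit Types (I J L M G : set R) (u v f : R).

Lemma ideal_span_is_ideal G : is_ideal (ideal_span G).
Proof.
split=> [L [[L0 _ _] _] //|u v Gu Gv L LG|a u Gu L LG].
  by case: (LG) => -[_ LD _] _; apply: LD; [apply: Gu|apply: Gv].
by case: (LG) => -[_ _ LM] _; apply: LM; apply: Gu.
Qed.

Lemma ideal_span_subset G : G `<=` ideal_span G.
Proof. exact: sub_smallest. Qed.

Lemma ideal_span_min G L : is_ideal L -> G `<=` L -> ideal_span G `<=` L.
Proof. by move=> idL GL; apply: smallest_sub. Qed.

Lemma ideal_sum L (T : Type) (s : seq T) (P : pred T) (F : T -> R) :
  is_ideal L -> (forall i, P i -> L (F i)) -> L (\sum_(i <- s | P i) F i).
Proof. by case=> L0 LD _ LF; elim/big_ind: _. Qed.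

Lemma ideal_opp L u : is_ideal L -> L u -> L (- u).
Proof. by case=> _ _ LM /(LM (-1)); rewrite mulN1r. Qed.

Lemma ideal_mul_mem I J u v : I u -> J v -> ideal_mul I J (u * v).
Proof. by move=> Iu Jv; apply: ideal_span_subset; exists u => //; exists v. Qed.

Lemma ideal_pow_is_ideal I k : is_ideal (ideal_pow I k).
Proof. by case: k => [|k]; [split | apply: ideal_span_is_ideal]. Qed.

Lemma ideal_pow_mul I a b u v :
  ideal_pow I a u -> ideal_pow I b v -> ideal_pow I (a + b) (u * v).
Proof.
elim: a u => [|a IH] u Iu Iv.
  by case: (ideal_pow_is_ideal I b) => _ _; apply.
have [I0 ID IM] := ideal_pow_is_ideal I (a.+1 + b).
suff /(_ u Iu) : ideal_pow I a.+1 `<=` [set w | ideal_pow I (a.+1 + b) (w * v)].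
  by [].
apply: ideal_span_min => [|_ [x Ix [y Iy <-]]] /=.
  split=> /= [|x y Ix Iy|x y Iy]; first by rewrite mul0r.
    by rewrite mulrDl; apply: ID.
  by rewrite -mulrA; apply: IM.
by rewrite -mulrA; exact: (ideal_mul_mem Ix (IH _ Iy Iv)).
Qed.

Lemma ideal_pow_subset I a b : (a <= b)%N -> ideal_pow I b `<=` ideal_pow I a.
Proof.
move=> /subnK <-; elim: (b - a)%N => [//|d IH].
apply: ideal_span_min; first exact: ideal_pow_is_ideal.
by move=> _ [x _ [y /IH Iy <-]]; case: (ideal_pow_is_ideal I a) => _ _; apply.
Qed.

(** Each use of the equation of integral dependence trades a factor [f ^+ i]
for an element of [I ^ i], so at most [n] factors of a power of [f] are
lost. This bounded defect is the trace of integrality that survives taking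
leading monomials. *)
Lemma integral_closure_pow I f : integral_closure I f ->
  exists N, forall l, ideal_pow I (l - N) (f ^+ l).
Proof.
case=> n [r [n_gt0 rI eqf]]; exists n => l.
elim/ltn_ind: l => l IH.
have [ltln|lenl] := ltnP l n.
  by have/eqP-> : (l - n == 0)%N by rewrite subn_eq0 ltnW.
have idI := ideal_pow_is_ideal I (l - n).
rewrite -(subnK lenl) exprD.
move/eqP: eqf; rewrite addr_eq0 => /eqP->; rewrite mulrN.
apply: ideal_opp; first by rewrite addnK.
rewrite addnK big_nat mulr_sumr; apply: ideal_sum => // i /andP[i_gt0 lein].
rewrite mulrCA -exprD addnBA // subnK //.
apply: (@ideal_pow_subset I _ (i + (l - i - n))); first by lia.
apply: ideal_pow_mul; first by apply: rI; rewrite i_gt0.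
by apply: IH; lia.
Qed.

End IdealPowers.

Section Rees.
Variables (R : comNzRingType) (I : set R).

Definition rees : {pred {poly R}} := fun p => `[< forall i, ideal_pow I i p`_i >].

Lemma reesP (p : {poly R}) : reflect (forall i, ideal_pow I i p`_i) (p \in rees).
Proof. exact: asboolP. Qed.

Fact rees_subring_closed : subring_closed rees.
Proof.
split=> [|p q /reesP Ip /reesP Iq|p q /reesP Ip /reesP Iq]; apply/reesP=> i.
- rewrite coef1; case: i => [//|i].
  by case: (ideal_pow_is_ideal I i.+1).
- have idI := ideal_pow_is_ideal I i; case: (idI) => _ ID _.
  by rewrite coefB; apply: ID => //; apply: ideal_opp.
rewrite coefM; apply: ideal_sum => [|j _]; first exact: ideal_pow_is_ideal.
by rewrite -{1}(subnKC (ltnSE (ltn_ord j))); apply: ideal_pow_mul.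
Qed.

HB.instance Definition _ :=
  GRing.isSubringClosed.Build {poly R} rees rees_subring_closed.

(** The Rees algebra of [I], the polynomials whose coefficient of degree [i]
lies in [I ^ i]. *)
Record rees_algebra := ReesAlgebra {rees_val : {poly R}; _ : rees_val \in rees}.

HB.instance Definition _ := [isSub for rees_val].
HB.instance Definition _ := [Choice of rees_algebra by <:].
HB.instance Definition _ := [SubChoice_isSubComNzRing of rees_algebra by <:].

(** An equation of integral dependence of [f] over [I] is, degree by degree, a
monic equation for [f * 'X] over the Rees algebra. Conversely, reading such an
equation of degree [n] in degree [n] of ['X] gives one for [f]. The Rees algebra
enters through an arbitrary ring morphism with image [rees]. *)
Lemma integral_closure_rees (T : comNzRingType) (phi : {rmorphism T -> {poly R}})
    (phi_rees : forall x, phi x \in rees)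
    (rees_phi : forall q, q \in rees -> exists x, phi x = q) f :
  integral_closure I f <-> integralOver phi (f%:P * 'X).
Proof.
split=> [[n [r [n_gt0 rI eqf]]]|[p p_monic p_root]].
  have /choice[rho rhoE] j :
      exists x, (1 <= j <= n)%N -> phi x = (r j)%:P * 'X^j.
    have [jn|_] := boolP (1 <= j <= n)%N; last by exists 0.
    suff /rees_phi[x <-] : (r j)%:P * 'X^j \in rees by exists x.
    apply/reesP => i; rewrite coefCM coefXn.
    have [->|_] := eqVneq i j; first by rewrite mulr1; apply: rI.
    by rewrite mulr0; case: (ideal_pow_is_ideal I i).
  exists ('X^n + \poly_(i < n) rho (n - i)%N).
    rewrite monicE lead_coefDl ?lead_coefXn // size_polyXn ltnS.
    exact: size_poly.
  rewrite /root rmorphD /= map_polyXn hornerD hornerXn.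
  rewrite poly_def raddf_sum /= horner_sum.
  have term (i : 'I_n) : (map_poly phi (rho (n - i)%N *: 'X^i)).[f%:P * 'X] =
      (r (n - i)%N * f ^+ i)%:P * 'X^n.
    rewrite -mul_polyC rmorphM /= map_polyC map_polyXn hornerM hornerC hornerXn.
    transitivity ((r (n - i)%N)%:P * 'X^(n - i) * (f%:P * 'X) ^+ i).
      by congr (_ * _); apply: rhoE; rewrite subn_gt0 ltn_ord leq_subr.
    rewrite exprMn mulrACA -exprD subnK 1?ltnW //.
    by rewrite -rmorphXn -rmorphM.
  rewrite (eq_bigr _ (fun i _ => term i)).
  rewrite -mulr_suml exprMn -mulrDl -rmorphXn -rmorph_sum -rmorphD /=.
  suff -> : f ^+ n + \sum_(i < n) r (n - i)%N * f ^+ i = 0 by rewrite mul0r.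
  apply: etrans eqf; congr (_ + _).
  rewrite big_add1 /= big_mkord (reindex_inj rev_ord_inj) /=.
  by apply: eq_bigr => i _; rewrite subKn.
pose n := (size p).-1.
have size_p : size p = n.+1.
  by rewrite /n prednK // size_poly_gt0 monic_neq0.
exists n, (fun j => (phi p`_(n - j))`_j); split.
- rewrite lt0n; apply/eqP=> n0.
  move: p_root p_monic; rewrite (@size1_polyC _ p) ?size_p ?n0 // => rt.
  rewrite monicE lead_coefC => /eqP p0; move: rt.
  by rewrite p0 map_polyC /= !rmorph1 (negPf (root1 _)).
- by move=> i _; apply/reesP.
move/rootP: p_root; rewrite -[p in map_poly _ p]coefK poly_def size_p.
rewrite raddf_sum horner_sum => /(congr1 (fun q : {poly R} => q`_n)).
rewrite coef0 coef_sum => root0; apply: etrans root0.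
rewrite big_ord_recr /= addrC; congr (_ + _); last first.
  rewrite big_add1 /= big_mkord [RHS](reindex_inj rev_ord_inj) /=.
  apply: eq_bigr => i _.
  rewrite -mul_polyC rmorphM /= map_polyC map_polyXn hornerM.
  rewrite hornerC hornerXn exprMn mulrA coefMXn ltnNge leq_subr /=.
  by rewrite subKn // -rmorphXn coefMC.
rewrite -mul_polyC rmorphM /= map_polyC map_polyXn hornerM.
rewrite hornerC hornerXn exprMn mulrA coefMXn ltnn subnn -rmorphXn coefMC.
have -> : p`_n = 1 by apply/eqP; rewrite -monicE.
transitivity ((1 : {poly R})`_0 * f ^+ n); first by rewrite coef1 mul1r.
by congr (_`_0 * _); rewrite -(rmorph1 phi).
Qed.

(** Elements integral over the Rees algebra form a ring. *)
Lemma integral_closure_add f g :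
  integral_closure I f -> integral_closure I g -> integral_closure I (f + g).
Proof.
have inP (x : rees_algebra) : val x \in rees by apply: valP.
have outP q : q \in rees -> exists x : rees_algebra, val x = q.
  by move=> Iq; exists (ReesAlgebra Iq).
move=> /(integral_closure_rees inP outP) If /(integral_closure_rees inP outP) Ig.
apply/(integral_closure_rees inP outP).
by rewrite rmorphD mulrDl; apply: integral_add.
Qed.

End Rees.

(** * Dickson's lemma and powers of up-closed sets of exponents *)

Section Dickson.

(** Keep moving to a point where the tail of the sequence attains its
minimum. *)
Lemma nat_nondecreasing_subseq (g : nat -> nat) : exists phi : nat -> nat,
  {homo phi : i j / (i < j)%N} /\ {homo g \o phi : i j / (i <= j)%N}.
Proof.
have /choice[pick pickP] N :
    exists i, (N <= i)%N /\ forall j, (N <= j)%N -> (g i <= g j)%N.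
  have exv : exists v, `[< exists2 i, (N <= i)%N & g i = v >].
    by exists (g N); apply/asboolP; exists N.
  case: (ex_minnP exv) => v /asboolP[i Ni <-] imin; exists i; split=> // j Nj.
  by apply: imin; apply/asboolP; exists j.
pose phi := fix phi k := pick (if k is k'.+1 then (phi k').+1 else 0%N).
have phiS k : (phi k < phi k.+1)%N by case: (pickP (phi k).+1).
exists phi; split; first exact: (homo_ltn ltn_trans).
apply: (homo_leq leqnn leq_trans) => k /=.
case: k => [|k] /=; first by case: (pickP 0%N) => _; apply.
case: (pickP (phi k).+1) => _; apply.
exact: ltn_trans (phiS k) (phiS k.+1).
Qed.

(** Dickson's lemma, in the form of a subsequence: refine once for each
coordinate. *)
Lemma dickson_subseq (T : finType) (F : nat -> T -> nat) :
  exists phi : nat -> nat, {homo phi : i j / (i < j)%N} /\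
    forall c, {homo (fun i => F (phi i) c) : i j / (i <= j)%N}.
Proof.
suff [phi [phi_lt phiF]] : exists phi : nat -> nat,
    {homo phi : i j / (i < j)%N} /\
    {in enum T, forall c, {homo (fun i => F (phi i) c) : i j / (i <= j)%N}}.
  by exists phi; split=> // c; apply: phiF; rewrite mem_enum.
elim: (enum T) => [|c cs [phi [phi_lt phiF]]]; first by exists id; split.
have [psi [psi_lt psiF]] := nat_nondecreasing_subseq (fun i => F (phi i) c).
exists (phi \o psi); split=> [i j ij|d]; first exact/phi_lt/psi_lt.
rewrite inE => /orP[/eqP-> //|/phiF Fd] i j ij; apply: Fd.
by move: ij; rewrite leq_eqVlt => /orP[/eqP->//|/psi_lt/ltnW].
Qed.

(** If no finite part of [D] lay below all of [D], one could choose each new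
element of [D] not above any earlier one, against [dickson_subseq]. *)
Lemma finite_basis n (D : set 'X_{1..n}) : exists gens : seq 'X_{1..n},
  {in gens, forall g, D g} /\
  forall u, D u -> exists2 g, g \in gens & (g <= u)%MM.
Proof.
apply: contrapT => /forallNP nobasis.
have /choice[pick pickP] (s : seq 'X_{1..n}) : exists u, {in s, forall g, D g} ->
    D u /\ {in s, forall g, ~~ (g <= u)%MM}.
  have [sD|nsD] := pselect {in s, forall g, D g}; last by exists 0%MM.
  have /not_andP[//|/existsNP[u /not_implyP[Du nu]]] := nobasis s.
  exists u => _; split=> // g gs; apply/negP=> gu; apply: nu; by exists g.
pose hist := fix hist k := if k is k'.+1 then pick (hist k') :: hist k' else [::].
have histD k : {in hist k, forall g, D g}.
  elim: k => [//|k IH] g; rewrite inE => /orP[/eqP->|/IH//].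
  by case: (pickP _ IH).
have hist_mem i j : (i < j)%N -> pick (hist i) \in hist j.
  elim: j => [//|j IH]; rewrite ltnS leq_eqVlt inE => /orP[/eqP->|/IH->].
    by rewrite eqxx.
  by rewrite orbT.
have [phi [phi_lt phiF]] := dickson_subseq (fun k => pick (hist k) : 'I_n -> nat).
have [_ /(_ _ (hist_mem _ _ (phi_lt 0%N 1%N isT)))/mnm_lepP[]] :=
  pickP _ (histD (phi 1%N)).
by move=> c; apply: phiF.
Qed.

End Dickson.

Section UpSets.
Variable n : nat.
Implicit Types (D E : set 'X_{1..n}) (s t u : 'X_{1..n}).

Definition upset D := forall s t, D s -> D (s + t)%MM.

Lemma upset_le D s t : upset D -> (s <= t)%MM -> D s -> D t.
Proof. by move=> upD /submK <- Ds; rewrite addmC; apply: upD. Qed.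

Definition addset D E : set 'X_{1..n} :=
  [set t | exists s, exists r, [/\ D s, E r & t = (s + r)%MM]].

Definition upow D k := iter k (addset D) setT.

Lemma upow_up D k : upset (upow D k).
Proof.
elim: k => [//|k IH] _ t [s [r [Ds Dr ->]]].
by exists s, (r + t)%MM; split=> //; [apply: IH | rewrite addmA].
Qed.

Lemma upow_add D a b s t :
  upow D a s -> upow D b t -> upow D (a + b) (s + t)%MM.
Proof.
move=> + Dt; elim: a s => [|a IH] s; first by rewrite addmC => _; apply: upow_up.
by case=> x [y [Dx /IH Dy ->]]; exists x, (y + t)%MM; rewrite addmA.
Qed.

Lemma upow1 D s : D s -> upow D 1 s.
Proof. by move=> Ds; exists s, 0%MM; rewrite addm0. Qed.

Lemma upow_subset D a b : (a <= b)%N -> upow D b `<=` upow D a.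
Proof.
move=> /subnKC <- t; elim: (b - a)%N t => [|d IH] t; first by rewrite addn0.
by rewrite addnS => -[x [y [_ /IH Dy ->]]]; rewrite addmC; apply: upow_up.
Qed.

Lemma mulmnA u a b : (u *+ (a * b) = (u *+ a) *+ b)%MM.
Proof. by apply/mnmP => i; rewrite !mulmnE mulnA. Qed.

Lemma mulmnDl u t a : ((u + t) *+ a = u *+ a + t *+ a)%MM.
Proof. by apply/mnmP => i; rewrite mnmDE !mulmnE mnmDE mulnDl. Qed.

Lemma upow_muln D a k s : upow D a s -> upow D (a * k) (s *+ k)%MM.
Proof.
move=> Ds; elim: k => [|k IH]; first by rewrite muln0.
by rewrite mulnS mulmS; apply: upow_add.
Qed.

Lemma upow_upow D a b : upow (upow D a) b = upow D (a * b).
Proof.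
elim: b => [|b IH]; first by rewrite muln0.
rewrite mulnS /= -/(upow _ b) IH; apply/seteqP; split=> t.
  by case=> s [r [Ds Dr ->]]; apply: upow_add.
clear IH; move: (a * b)%N => c; elim: a t => [|a IH] t Dt.
  by exists 0%MM, t; rewrite add0m.
case: Dt => x [y [Dx /IH[s [r [Ds Dr ->]]] ->]].
exists (x + s)%MM, r; rewrite addmA; split=> //.
by exists x, s.
Qed.

Lemma upow_nonempty D k : (exists s, D s) -> exists s, upow D k s.
Proof.
case=> s Ds; exists (s *+ k)%MM.
by have := upow_muln k (upow1 Ds); rewrite mul1n.
Qed.

Section Generators.
Variables (D : set 'X_{1..n}) (N : nat) (g : 'I_N -> 'X_{1..n}).
Hypotheses (gD : forall i, D (g i))
  (Dg : forall u, D u -> exists i, (g i <= u)%MM).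

Lemma upow_gens (a : 'I_N -> nat) (t : 'X_{1..n}) :
  (forall c, (\sum_i g i c * a i <= t c)%N) -> upow D (\sum_i a i)%N t.
Proof.
move=> le_t; apply: (@upset_le _ (\sum_i g i *+ a i)%MM).
- exact: upow_up.
- apply/mnm_lepP => c; rewrite mnm_sumE.
  by under eq_bigr do rewrite mulmnE.
elim/big_rec2: _ => [//|i k s _ Ds]; apply: upow_add => //.
by have := upow_muln (a i) (upow1 (gD i)); rewrite mul1n.
Qed.

(** With finitely many generators, membership in the [k]-th power is witnessed
by a vector of multiplicities, to which Dickson's lemma and pigeonhole
arguments apply. *)
Lemma upow_gensP k t : upow D k t ->
  exists a : 'I_N -> nat, (\sum_i a i = k)%N /\
    forall c, (\sum_i g i c * a i <= t c)%N.
Proof.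
elim: k t => [|k IH] t.
  by exists (fun=> 0%N); split=> [|c]; rewrite big1 // => i _; rewrite muln0.
case=> s [r [/Dg[j /mnm_lepP gj] /IH[a [suma le_r]] ->]].
exists (fun i => (i == j) + a i)%N; split=> [|c].
  by rewrite big_split /= suma -big_mkcond big_pred1_eq.
under eq_bigr do rewrite mulnDr.
rewrite big_split mnmDE leq_add //= (bigD1 j) //= eqxx muln1 big1 ?addn0 //.
by move=> i /negPf->; rewrite muln0.
Qed.

End Generators.

Lemma generators D : exists N (g : 'I_N -> 'X_{1..n}),
  (forall i, D (g i)) /\ forall u, D u -> exists i, (g i <= u)%MM.
Proof.
have [s [sD Ds]] := finite_basis D.
exists (size s), (tnth (in_tuple s)); split=> [i|u /Ds[g gs gu]].
  exact/sD/mem_tnth.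
by have /tnthP[i gE] : g \in in_tuple s by []; exists i; rewrite -gE.
Qed.

(** The exponents of the monomials in the integral closure of the monomial ideal
with exponent set [D]; see [integral_closure_monset]. *)
Definition clos D : set 'X_{1..n} :=
  [set u | exists2 r, (0 < r)%N & upow D r (u *+ r)%MM].

Lemma clos_up D : upset (clos D).
Proof.
move=> s t [r r_gt0 Ds]; exists r => //; rewrite mulmnDl; exact: upow_up.
Qed.

Lemma clos_sub D : D `<=` clos D.
Proof. by move=> s Ds; exists 1%N => //; apply: upow1. Qed.

Lemma clos_subset D E : D `<=` E -> clos D `<=` clos E.
Proof.
move=> DE u [r r_gt0 Du]; exists r => //.
elim: r (u *+ r)%MM Du {r_gt0} => [//|r IH] t [x [y [/DE Ex /IH Ey ->]]].
by exists x, y.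
Qed.

(** Write [c + l u] as a sum of [l] generators plus a remainder. By Dickson's
lemma, both the multiplicities and the remainder increase weakly between two
indices [l < l']; the difference of the two expressions shows that
[(l' - l) u] lies in the power [l' - l]. *)
Lemma clos_asymptotic D c u :
  (forall l, upow D l (c + u *+ l)%MM) -> clos D u.
Proof.
move=> Dl; have [N [g [gD Dg]]] := generators D.
have /choice[a aP] l := upow_gensP Dg (Dl l).
pose S l j := (\sum_i g i j * a l i)%N.
have [phi [phi_lt phiF]] := dickson_subseq (fun l (x : 'I_N + 'I_n) =>
  match x with inl i => a l i | inr j => (c + u *+ l)%MM j - S l j end)%N.
have lt01 := phi_lt 0%N 1%N isT.
set l := phi 0%N in lt01; set l' := phi 1%N in lt01.
have le_a i : (a l i <= a l' i)%N := phiF (inl i) 0%N 1%N isT.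
have le_b j := phiF (inr j) 0%N 1%N isT.
exists (l' - l)%N; first by rewrite subn_gt0.
have [[suml leS] [suml' leS']] := (aP l, aP l').
have {1}<- : (\sum_i (a l' i - a l i) = l' - l)%N.
  by rewrite sumnB => [|i _]; rewrite ?suml ?suml'.
apply: (upow_gens gD) => j.
under eq_bigr do rewrite mulnBr.
rewrite sumnB => [|i _]; last by rewrite leq_mul2l le_a orbT.
have := le_b j; have := leS j; have := leS' j.
rewrite !mnmDE !mulmnE mulnBr -/(S l j) -/(S l' j) /=.
rewrite -/l -/l'; lia.
Qed.

(** The monomial case of cancelling an ideal [I] in the inclusion of [u I] in
the closure of [I ^ k.+1]. Let [R] be a common exponent with
[R (u + g)] in the power [k.+1 * R] for each of the [N] generators [g]. A
product of at least [N * R] generators contains some [g] with multiplicity [R],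
and trading it for [R (u + g)] shows that adding [R u] gains [k * R] powers.
Iterating this step puts [u *+ R] under the hypothesis of
[clos_asymptotic]. *)
Lemma clos_cancel D k u : (exists s, D s) ->
  (forall g, D g -> clos (upow D k.+1) (u + g)%MM) -> clos (upow D k) u.
Proof.
move=> neD Dclos; have [N [g [gD Dg]]] := generators D.
have /choice[r rP] i : exists r, (0 < r)%N /\
    upow D (k.+1 * r) ((u + g i) *+ r)%MM.
  by have [r r_gt0 Dr] := Dclos _ (gD i); exists r; rewrite -upow_upow.
pose R := (\prod_i r i)%N.
have R_gt0 : (0 < R)%N by apply: prodn_gt0 => i; case: (rP i).
have DR i : upow D (k.+1 * R) ((u + g i) *+ R)%MM.
  have /dvdnP[q ->] : (r i %| R)%N by rewrite /R (bigD1 i) //= dvdn_mulr.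
  rewrite [(q * _)%N]mulnC mulnA mulmnA.
  by apply: upow_muln; case: (rP i).
have step M t : (N * R <= M)%N -> upow D M t ->
    upow D (M + k * R) (t + u *+ R)%MM.
  move=> NRM /(upow_gensP Dg)[a [sum_a le_t]].
  (* otherwise the N multiplicities, all below R, add up to less than N * R *)
  have [i Rai] : exists i, (R <= a i)%N.
    apply: contrapT => /forallNP small.
    have N_gt0 : (0 < N)%N.
      by case: neD => s /Dg[[i iN] _]; apply: leq_ltn_trans iN.
    have : (\sum_i (a i).+1 <= \sum_(i < N) R)%N.
      by apply: leq_sum => i _; rewrite ltnNge; apply/negP/small.
    under eq_bigr do rewrite -addn1.
    by rewrite big_split /= !sum_nat_const card_ord muln1 sum_a; lia.
  pose b j := (a j - (j == i) * R)%N.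
  have ab j : a j = (b j + (j == i) * R)%N.
    rewrite /b subnK //; case: eqP => [->|_]; last by [].
    by rewrite mul1n.
  have sum_i (F : 'I_N -> nat) : (\sum_j F j * ((j == i) * R) = F i * R)%N.
    rewrite (bigD1 i) //= eqxx mul1n big1 ?addn0 // => j /negPf->.
    by rewrite muln0.
  have sum_b : (M = \sum_j b j + R)%N.
    rewrite -sum_a -(eq_bigr _ (fun j _ => esym (ab j))) big_split /=.
    have := sum_i (fun=> 1%N); under eq_bigr do rewrite mul1n.
    by move=> ->; rewrite mul1n.
  have le_b c : (\sum_j g j c * b j + g i c * R <= t c)%N.
    apply: leq_trans (le_t c); rewrite -(sum_i (fun j => g j c)) -big_split.
    by apply: leq_sum => j _; rewrite /= -mulnDr -ab.
  have gt : (g i *+ R <= t)%MM.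
    by apply/mnm_lepP => c; rewrite mulmnE; move: (le_b c); lia.
  rewrite -(submK gt) -addmA [(g i *+ R + _)%MM]addmC -mulmnDl.
  have -> : (M + k * R = \sum_j b j + k.+1 * R)%N by rewrite sum_b mulSn; lia.
  apply: upow_add => //; apply: (upow_gens gD) => c.
  by rewrite mnmBE mulmnE; move: (le_b c); lia.
have [c Dc] := upow_nonempty (N * R) neD.
have iter_step m : upow D (N * R + k * R * m) (c + u *+ R *+ m)%MM.
  elim: m => [|m IH]; first by rewrite muln0 addn0 addm0.
  rewrite mulnS [(k * R + _)%N]addnC addnA mulmSr addmA.
  by apply: step => //; rewrite leq_addr.
have [|r' r'_gt0] := @clos_asymptotic (upow D (k * R)) c (u *+ R)%MM.
  by move=> l; rewrite upow_upow; apply: upow_subset (iter_step l); apply: leq_addl.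
rewrite upow_upow -mulnA -upow_upow -mulmnA => Du.
by exists (R * r')%N => //; rewrite muln_gt0 R_gt0.
Qed.

End UpSets.

(** * Monomial ideals and their integral closures *)

Section Dictionary.
Variables (K : fieldType) (n : nat).
Implicit Types (D E H : set 'X_{1..n}) (s t u : 'X_{1..n}) (f : {mpoly K[n]}).

Definition monset D : set {mpoly K[n]} := [set f | forall t, t \in msupp f -> D t].

Lemma monset_is_ideal D : upset D -> is_ideal (monset D).
Proof.
move=> upD; split=> [t|f g Df Dg t|a f Df t].
- by rewrite msupp0.
- by move/msuppD_le; rewrite mem_cat => /orP[/Df|/Dg].
move/msuppM_le/allpairsP => -[[s r] /= [_ /Df Dr ->]].
by rewrite addmC; apply: upD.
Qed.

Lemma monsetX D t : monset D 'X_[K, t] <-> D t.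
Proof.
split=> [|Dt s]; first by apply; rewrite msuppX mem_seq1.
by rewrite msuppX mem_seq1 => /eqP->.
Qed.

Lemma mpolyX_neq0 t : 'X_[K, t] != 0.
Proof. by rewrite -msupp_eq0 msuppX. Qed.

Lemma ideal_monomials (L : set {mpoly K[n]}) f : is_ideal L ->
  (forall t, t \in msupp f -> L 'X_[K, t]) -> L f.
Proof.
move=> idL Lf; rewrite [f]mpolyE big_seq; apply: ideal_sum => // t /Lf Lt.
by rewrite -mul_mpolyC; case: idL => _ _; apply.
Qed.

Lemma ideal_span_monset D (G : set {mpoly K[n]}) : upset D -> G `<=` monset D ->
  (forall t, D t -> ideal_span G 'X_[K, t]) -> ideal_span G = monset D.
Proof.
move=> upD GD DG; apply/seteqP; split.
  by apply: ideal_span_min => //; apply: monset_is_ideal.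
move=> f Df; apply: ideal_monomials; first exact: ideal_span_is_ideal.
by move=> t /Df /DG.
Qed.

Lemma ideal_monomials_up (L : set {mpoly K[n]}) :
  is_ideal L -> upset [set t | L 'X_[K, t]].
Proof. by move=> [_ _ LM] s t /= Ls; rewrite mpolyXD mulrC; apply: LM. Qed.

Lemma monomial_idealE (L : set {mpoly K[n]}) : is_monomial_ideal L ->
  exists2 D, upset D & L = monset D.
Proof.
case=> M LE; have idL : is_ideal L by rewrite LE; apply: ideal_span_is_ideal.
exists [set t | L 'X_[K, t]]; first exact: ideal_monomials_up.
rewrite [LHS]LE; apply: ideal_span_monset; first exact: ideal_monomials_up.
  move=> _ [t Mt <-]; apply/monsetX; rewrite /= LE.
  by apply: ideal_span_subset; exists t.
by move=> t /=; rewrite LE.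
Qed.

Lemma addset_up D E : upset D -> upset (addset D E).
Proof.
move=> upD _ u [s [t [Ds Et ->]]]; exists (s + u)%MM, t; split=> //.
  exact: upD.
by rewrite -!addmA [(u + t)%MM]addmC.
Qed.

Lemma ideal_mul_monset D E : upset D -> upset E ->
  ideal_mul (monset D) (monset E) = monset (addset D E).
Proof.
move=> upD upE; apply: ideal_span_monset.
- exact: addset_up.
- move=> _ [f Df [g Eg <-]] _ /msuppM_le/allpairsP[[s r] /= [/Df Ds /Eg Er ->]].
  by exists s, r.
move=> _ [s [r [Ds Er ->]]]; apply: ideal_span_subset.
exists 'X_[K, s]; first exact/monsetX.
by exists 'X_[K, r]; [apply/monsetX | rewrite mpolyXD].
Qed.

Lemma ideal_pow_monset D k : upset D -> ideal_pow (monset D) k = monset (upow D k).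
Proof.
move=> upD; elim: k => [|k IH]; first by apply/seteqP; split.
by rewrite /= -/(ideal_pow _ k) IH ideal_mul_monset //; apply: upow_up.
Qed.

(** Leading monomials are multiplicative, so the asymptotic membership of the
powers of [f] passes to [mlead f], and then to [f] without its leading term. *)
Lemma asymptotic_clos D c f : c != 0 ->
  (forall l, monset (upow D l) (c * f ^+ l)) -> monset (clos D) f.
Proof.
elim/mleadrect: f c => f IH c c_neq0 Dl.
have [->|f_neq0] := eqVneq f 0; first by move=> t; rewrite msupp0.
have lead_asymp l : upow D l (mlead c + mlead f *+ l)%MM.
  rewrite -mleadX // -mleadM ?expf_neq0 //; apply: Dl.
  by rewrite mlead_supp // mulf_neq0 // expf_neq0.
have lead_clos := clos_asymptotic lead_asymp.
pose g := f - mleadc f *: 'X_[mlead f].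
have id_clos := monset_is_ideal (clos_up (D := D)).
have Dg : monset (clos D) g.
  have [->|g_neq0] := eqVneq g 0; first by case: id_clos.
  (* the powers of g mix those of f, controlled by c, and those of the leading
     term of f, controlled by mlead c *)
  apply: (IH _ _ (c * 'X_[mlead c])).
  - have supp_g : mlead g \in rem (mlead f) (msupp f).
      by rewrite -(perm_mem (msupp_rem f (mlead f))) mlead_supp.
    move: supp_g; rewrite mem_rem_uniq ?msupp_uniq // inE /=.
    by case/andP=> ne /msupp_le_mlead; rewrite Order.POrderTheory.le_eqVlt (negPf ne).
  - by rewrite mulf_neq0 // mpolyX_neq0.
  move=> l; rewrite exprBn mulr_sumr; apply: ideal_sum.
    exact/monset_is_ideal/upow_up.
  move=> i _; rewrite mulrnAr -mulr_natl.
  have [_ _ LM] := monset_is_ideal (@upow_up _ D l); apply: (LM).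
  set z := (-1) ^+ i; rewrite exprZn mpolyXn -mul_mpolyC.
  have -> : c * 'X_[mlead c] * (z * f ^+ (l - i) *
      ((mleadc f ^+ i)%:MP * 'X_[(mlead f *+ i)%MM])) =
      (z * (mleadc f ^+ i)%:MP) *
      ((c * f ^+ (l - i)) * 'X_[(mlead c + mlead f *+ i)%MM]).
    by rewrite mpolyXD; ring.
  apply: LM => t /msuppM_le/allpairsP[[s r] /= [/Dl Ds]].
  rewrite msuppX mem_seq1 => /eqP-> ->.
  rewrite -{1}(subnK (ltnSE (ltn_ord i))); exact: upow_add.
rewrite -(subrK (mleadc f *: 'X_[mlead f]) f) -/g.
case: id_clos => _ ID IM; apply: ID => //.
by rewrite -mul_mpolyC; apply: IM; apply/monsetX.
Qed.

(** A monomial [u] of the closure satisfies the pure equation [x ^+ r = a] with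
[a] in the [r]-th power of the ideal, and integral elements can be added. In the
other direction, multiplying by a monomial [c] of the [N]-th power absorbs the
defect of [integral_closure_pow]. *)
Lemma integral_closure_monset D : upset D -> (exists s, D s) ->
  integral_closure (monset D) = monset (clos D).
Proof.
move=> upD neD; apply/seteqP; split=> f.
  case/integral_closure_pow => N DN.
  have [c Dc] := upow_nonempty N neD.
  apply: (@asymptotic_clos _ 'X_[c]) => //; first by exact: mpolyX_neq0.
  move=> l; rewrite -ideal_pow_monset //.
  apply: (@ideal_pow_subset _ _ _ (N + (l - N))%N); first by lia.
  by apply: ideal_pow_mul => //; rewrite ideal_pow_monset //; apply/monsetX.
move=> Df; rewrite [f]mpolyE big_seq.
apply: (@big_ind _ (integral_closure (monset D))).
- exists 1%N, (fun=> 0); split=> // [i _|].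
    by case: (ideal_pow_is_ideal (monset D) i).
  by rewrite big_nat1 expr1 mul0r addr0.
- exact: integral_closure_add.
move=> t /Df[r r_gt0 Dr].
set x := f@_t *: 'X_[t].
exists r, (fun i => if i == r then - x ^+ r else 0); split=> // [i _|].
  case: eqP => [->|_]; last by case: (ideal_pow_is_ideal (monset D) i).
  apply: ideal_opp; first exact: ideal_pow_is_ideal.
  rewrite ideal_pow_monset // /x exprZn mpolyXn -mul_mpolyC.
  have [_ _ LM] := monset_is_ideal (@upow_up _ D r).
  by apply: LM; apply/monsetX.
rewrite big_nat_recr //= eqxx subnn mulr1 big_nat big1 ?add0r ?subrr // => i.
by case/andP=> _ ltir; rewrite ltn_eqF // mul0r.
Qed.

End Dictionary.

Arguments monset K {n} D.

(** * Colon ideals and local v-numbers of monomial ideals *)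

Lemma is_min_exists (E : set nat) d : E d -> exists e, is_min E e.
Proof.
move=> Ed; have exE : exists d, `[< E d >] by exists d; apply/asboolP.
case: (ex_minnP exE) => e /asboolP Ee emin; exists e; split=> // c Ec.
exact/emin/asboolP.
Qed.

Section Colon.
Variables (K : fieldType) (n : nat).
Implicit Types (D H : set 'X_{1..n}) (s t u : 'X_{1..n}) (f : {mpoly K[n]}).

Definition mcolon D u : set 'X_{1..n} := [set t | D (u + t)%MM].

Lemma colon_monsetX D u :
  colon (monset K D) 'X_[u] = monset K (mcolon D u).
Proof.
apply/seteqP; split=> f Df t tf.
  by apply: Df; rewrite (perm_mem (msuppMX _ _)) map_f.
by move: tf; rewrite (perm_mem (msuppMX _ _)) => /mapP[s /Df Ds ->].
Qed.

Definition prime_upset H :=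
  [/\ upset H, ~ H 0%MM & forall s t, H (s + t)%MM -> H s \/ H t].

Lemma prime_monset H :
  upset H -> is_prime_ideal (monset K H) -> prime_upset H.
Proof.
move=> upH [_ H1 Hprime]; split=> // [H0|s t Hst].
  by apply: H1; rewrite -mpolyX0; apply/monsetX.
have /Hprime : monset K H ('X_[s] * 'X_[t]) by rewrite -mpolyXD; apply/monsetX.
by case=> /monsetX; [left | right].
Qed.

Lemma monomial_prime (p : set {mpoly K[n]}) : is_monomial_prime p ->
  exists H, [/\ p = monset K H, prime_upset H & is_prime_ideal (monset K H)].
Proof.
case=> /monomial_idealE[H upH ->] H_prime.
by exists H; split=> //; apply: prime_monset.
Qed.

(** Each monomial [u] of [f] has [H] inside its colon set. If for every [u] the
inclusion were strict, with [g u] a witness outside [H], then the sum of the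
[g u] would be outside [H] by primality, and yet multiply [f] into the
ideal. Hence associated primes and the local v-number are computed by
monomials alone. *)
Lemma colon_monset D H f : upset D -> prime_upset H ->
    colon (monset K D) f = monset K H ->
  exists2 u, u \in msupp f & mcolon D u = H.
Proof.
move=> upD [upH H0 Hprime] colonE.
have Hcolon u : u \in msupp f -> H `<=` mcolon D u.
  move=> uf t Ht; have : colon (monset K D) f 'X_[t].
    by rewrite colonE; apply/monsetX.
  by apply; rewrite mulrC (perm_mem (msuppMX _ _)) addmC map_f.
apply: contrapT => noterm.
have /choice[g gP] u : exists g, u \in msupp f -> ~ H g /\ D (u + g)%MM.
  have [uf|_] := boolP (u \in msupp f); last by exists 0%MM.
  apply: contrapT => /forallNP nog; apply: noterm; exists u => //.
  apply/seteqP; split; last exact: Hcolon.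
  by move=> t Dt; apply: contrapT => nHt; apply: (nog t).
have gH (s : seq 'X_{1..n}) : {subset s <= msupp f} ->
    ~ H (\big[mnm_add/0%MM]_(u <- s) g u).
  elim: s => [|u s IH] sf; first by rewrite big_nil.
  rewrite big_cons => /Hprime[|].
    by case: (gP u) => //; apply: sf; rewrite mem_head.
  by apply: IH => v vs; apply: sf; rewrite inE vs orbT.
apply: (gH (msupp f)) => //; apply/(@monsetX K); rewrite -colonE.
move=> t; rewrite mulrC (perm_mem (msuppMX _ _)) => /mapP[u uf ->].
have [_ Dug] := gP u uf.
by rewrite addmC (big_rem u) //= addmA; apply: upD.
Qed.

Lemma Ass_monset D H : upset D -> prime_upset H -> is_prime_ideal (monset K H) ->
  Ass (monset K D) (monset K H) <-> exists u, mcolon D u = H.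
Proof.
move=> upD primeH H_prime; split=> [[_ [f /colon_monset[] // u _ uH]]|[u uH]].
  by exists u.
by split; [| exists 'X_[u]; rewrite colon_monsetX uH].
Qed.

Lemma vnumber_monset D H : upset D -> prime_upset H ->
  (exists u, mcolon D u = H) ->
  is_min [set mdeg u | u in [set u | mcolon D u = H]]
    (vnumber (monset K H) (monset K D)).
Proof.
move=> upD primeH [u0 u0H].
have -> : [set mdeg u | u in [set u | mcolon D u = H]] =
    [set d | exists f : {mpoly K[n]},
      f \is d.-homog /\ colon (monset K D) f = monset K H].
  apply/seteqP; split=> d.
    case=> u <- <-; exists 'X_[u]; split; last exact: colon_monsetX.
    by rewrite dhomogX.
  case=> f [/dhomogP f_homog /colon_monset[] // u uf uH].
  by exists u => //; apply: f_homog.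
apply: xgetPex; apply: (@is_min_exists _ (mdeg u0)).
by exists 'X_[u0]; rewrite dhomogX colon_monsetX u0H.
Qed.

End Colon.

(** * Colon sets in a product of two filtrations *)

(** The sets [A i] and [B j] are the exponents of two decreasing filtrations by
monomial ideals in disjoint variables, and [pair_level] those of the [k]-th step
of the product filtration. The cancellation hypotheses say that a monomial whose
colon in a step of the filtration is the given prime lies in the step
before. *)
Section PairColon.
Variables (n m k : nat).
Variables (A : nat -> set 'X_{1..n}) (B : nat -> set 'X_{1..m}).
Variables (Hp : set 'X_{1..n}) (Hq : set 'X_{1..m}).
Hypotheses (A0 : A 0%N = setT) (B0 : B 0%N = setT).
Hypotheses (upA : forall i, upset (A i)) (upB : forall j, upset (B j)).
Hypotheses (decA : forall i j, (i <= j)%N -> A j `<=` A i)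
           (decB : forall i j, (i <= j)%N -> B j `<=` B i).
Hypotheses (Hp0 : ~ Hp 0%MM) (Hq0 : ~ Hq 0%MM).
Hypotheses (cancelA : forall i u, mcolon (A i.+1) u = Hp -> A i u)
           (cancelB : forall j v, mcolon (B j.+1) v = Hq -> B j v).

Definition pair_level (s : 'X_{1..n}) (r : 'X_{1..m}) : Prop :=
  exists i j, [/\ (i + j)%N = k, A i s & B j r].

(** Here [u] has level exactly [k - d.+1] and [v] level exactly [d], so their
levels add up to [k - 1] and one more step on either side suffices. *)
Lemma mcolon_pair d u v : (d < k)%N ->
  mcolon (A (k - d)) u = Hp -> mcolon (B d.+1) v = Hq ->
  forall s r, pair_level (u + s)%MM (v + r)%MM <-> Hp s \/ Hq r.
Proof.
move=> dk uHp vHq s r.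
have kd : (k - d = (k - d.+1).+1)%N by lia.
have Au : A (k - d.+1) u by apply: cancelA; rewrite -kd.
have Bv := cancelB vHq.
split=> [[i [j [ijk Ai Bj]]]|[Hps|Hqr]].
- have [kdi|idk] := leqP (k - d) i.
    by left; rewrite -uHp; apply: decA Ai.
  right; rewrite -vHq; apply: decB Bj; lia.
- exists (k - d)%N, d; split; first by lia.
    by rewrite -uHp in Hps.
  exact: upB.
exists (k - d.+1)%N, d.+1; split; first by lia.
  exact: upA.
by rewrite -vHq in Hqr.
Qed.

(** The index [d] is the level of [v]. Since [v] misses level [d.+1], multiples
of [u] can only reach the [k]-th step through [A (k - d)], which settles [u].
By cancellation [u] then has level exactly [k - d.+1], which leaves to the
multiples of [v] only [B d.+1]. *)
Lemma mcolon_unpair u v :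
  (forall s r, pair_level (u + s)%MM (v + r)%MM <-> Hp s \/ Hq r) ->
  exists d, [/\ (d < k)%N, mcolon (A (k - d)) u = Hp & mcolon (B d.+1) v = Hq].
Proof.
move=> uvH.
have not_uv : ~ pair_level u v.
  by move/(_ 0%MM 0%MM): uvH; rewrite !addm0 => -[uv0 _] /uv0[].
have exd : exists d, (d <= k)%N && `[< B d v >].
  by exists 0%N; apply/asboolP; rewrite B0.
have dmaxk d : (d <= k)%N && `[< B d v >] -> (d <= k)%N by case/andP.
case: (ex_maxnP exd dmaxk) => d /andP[ledk /asboolP Bd] dmax.
have maxB j : (j <= k)%N -> B j v -> (j <= d)%N.
  by move=> jk Bj; apply: dmax; rewrite jk; apply/asboolP.
have dk : (d < k)%N.
  rewrite ltn_neqAle ledk andbT; apply/eqP => dk; apply: not_uv.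
  by exists 0%N, k; split; rewrite ?A0 -?[in B _]dk.
have uHp : mcolon (A (k - d)) u = Hp.
  apply/seteqP; split=> s /= As.
    have : pair_level (u + s)%MM (v + 0)%MM.
      by exists (k - d)%N, d; rewrite addm0 subnK.
    by case/uvH.
  have /uvH : Hp s \/ Hq 0%MM by left.
  case=> i [j [ijk Ai]]; rewrite addm0 => /maxB jd; apply: decA Ai.
  by have := jd ltac:(lia); lia.
exists d; split=> //.
have kd : (k - d = (k - d.+1).+1)%N by lia.
have Au : A (k - d.+1) u by apply: cancelA; rewrite -kd.
apply/seteqP; split=> r /= Br.
  have : pair_level (u + 0)%MM (v + r)%MM.
    by exists (k - d.+1)%N, d.+1; rewrite addm0; split=> //; lia.
  by case/uvH.
have /uvH : Hp 0%MM \/ Hq r by right.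
case=> i [j [ijk]]; rewrite addm0 => Ai; apply: decB.
have [kdi|] := leqP (k - d) i; last by lia.
by case: Hp0; rewrite -uHp /mcolon /= addm0; apply: decA Ai.
Qed.

End PairColon.

(** * Monomial ideals in two disjoint sets of variables *)

Section Extension.
Variables (K : fieldType) (n m : nat).
Implicit Types (D : set 'X_{1..n}) (E : set 'X_{1..m}).
Implicit Types (s : 'X_{1..n}) (r : 'X_{1..m}) (t : 'X_{1..n + m}).

Definition lpart t : 'X_{1..n} := [multinom t (lshift m i) | i < n].
Definition rpart t : 'X_{1..m} := [multinom t (rshift n j) | j < m].
Definition joinm s r : 'X_{1..n + m} :=
  [multinom match split i with inl j => s j | inr j => r j end | i < n + m].

Lemma joinm_lshift s r i : joinm s r (lshift m i) = s i.
Proof. by rewrite mnmE -[lshift m i]/(unsplit (inl i)) unsplitK. Qed.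

Lemma joinm_rshift s r j : joinm s r (rshift n j) = r j.
Proof. by rewrite mnmE -[rshift n j]/(unsplit (inr j)) unsplitK. Qed.

Lemma lpart_joinm s r : lpart (joinm s r) = s.
Proof. by apply/mnmP => i; rewrite mnmE joinm_lshift. Qed.

Lemma rpart_joinm s r : rpart (joinm s r) = r.
Proof. by apply/mnmP => j; rewrite mnmE joinm_rshift. Qed.

Lemma mnm_splitP t t' :
  (forall i, t (lshift m i) = t' (lshift m i)) ->
  (forall j, t (rshift n j) = t' (rshift n j)) -> t = t'.
Proof.
by move=> tl tr; apply/mnmP => i; case: (split_ordP i) => j ->.
Qed.

Lemma joinmK t : joinm (lpart t) (rpart t) = t.
Proof.
by apply: mnm_splitP => i; rewrite (joinm_lshift, joinm_rshift) mnmE.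
Qed.

Lemma lpartD t t' : lpart (t + t')%MM = (lpart t + lpart t')%MM.
Proof. by apply/mnmP => i; rewrite !mnmE. Qed.

Lemma rpartD t t' : rpart (t + t')%MM = (rpart t + rpart t')%MM.
Proof. by apply/mnmP => i; rewrite !mnmE. Qed.

Lemma joinmD s s' r r' :
  joinm (s + s')%MM (r + r')%MM = (joinm s r + joinm s' r')%MM.
Proof.
by apply: mnm_splitP => i; rewrite mnmDE !(joinm_lshift, joinm_rshift) mnmDE.
Qed.

Lemma mdeg_split t : mdeg t = (mdeg (lpart t) + mdeg (rpart t))%N.
Proof.
rewrite !mdegE big_split_ord /=.
by congr (_ + _)%N; apply: eq_bigr => i _; rewrite mnmE.
Qed.

Lemma emblX s : embl m 'X_[K, s] = 'X_[joinm s 0%MM].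
Proof.
rewrite /embl comp_mpolyX.
rewrite (eq_bigr (fun i => 'X_[K, U_(lshift m i)] ^+ s i)) => [|i _]; last first.
  by rewrite tnth_mktuple.
rewrite mprodXnE; congr 'X_[_]; apply: mnm_splitP => j; rewrite mnm_sumE.
  rewrite joinm_lshift (bigD1 j) //= mulmnE mnm1E eqxx mul1n.
  rewrite big1 ?addn0 // => i /negPf ij.
  by rewrite mulmnE mnm1E (inj_eq (@lshift_inj _ _)) ij.
rewrite joinm_rshift mnm0E big1 // => i _.
by rewrite mulmnE mnm1E eq_lrshift.
Qed.

Lemma embrX r : embr n 'X_[K, r] = 'X_[joinm 0%MM r].
Proof.
rewrite /embr comp_mpolyX.
rewrite (eq_bigr (fun i => 'X_[K, U_(rshift n i)] ^+ r i)) => [|i _]; last first.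
  by rewrite tnth_mktuple.
rewrite mprodXnE; congr 'X_[_]; apply: mnm_splitP => j; rewrite mnm_sumE.
  by rewrite joinm_lshift mnm0E big1 // => i _; rewrite mulmnE mnm1E eq_rlshift.
rewrite joinm_rshift (bigD1 j) //= mulmnE mnm1E eqxx mul1n.
rewrite big1 ?addn0 // => i /negPf ij.
by rewrite mulmnE mnm1E (inj_eq (@rshift_inj _ _)) ij.
Qed.

Lemma lpart_up D : upset D -> upset (lpart @^-1` D).
Proof. by move=> upD t t' Dt; rewrite /preimage /= lpartD; apply: upD. Qed.

Lemma rpart_up E : upset E -> upset (rpart @^-1` E).
Proof. by move=> upE t t' Et; rewrite /preimage /= rpartD; apply: upE. Qed.

Lemma extl_monset D : upset D ->
  @extl K n m (monset K D) = monset K (lpart @^-1` D).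
Proof.
move=> upD; apply: ideal_span_monset; first exact: lpart_up.
  move=> _ [f Df <-].
  have idD := monset_is_ideal K (lpart_up upD).
  rewrite /embl comp_mpolyEX big_seq; apply: ideal_sum => // s sf.
  rewrite -mul_mpolyC; case: (idD) => _ _; apply.
  by rewrite -/(embl m _) emblX; apply/monsetX; rewrite /= lpart_joinm; apply: Df.
move=> t Dt; rewrite -[t]joinmK -[lpart t]add0m -[rpart t]addm0 joinmD mpolyXD.
case: (ideal_span_is_ideal [set embl m f | f in monset K D]) => _ _; apply.
by apply: ideal_span_subset; exists 'X_[lpart t]; rewrite ?emblX //; apply/monsetX.
Qed.

Lemma extr_monset E : upset E ->
  @extr K n m (monset K E) = monset K (rpart @^-1` E).
Proof.
move=> upE; apply: ideal_span_monset; first exact: rpart_up.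
  move=> _ [f Ef <-].
  have idE := monset_is_ideal K (rpart_up upE).
  rewrite /embr comp_mpolyEX big_seq; apply: ideal_sum => // r rf.
  rewrite -mul_mpolyC; case: (idE) => _ _; apply.
  by rewrite -/(embr n _) embrX; apply/monsetX; rewrite /= rpart_joinm; apply: Ef.
move=> t Et; rewrite -[t]joinmK -[rpart t]add0m -[lpart t]addm0 joinmD mpolyXD.
case: (ideal_span_is_ideal [set embr n f | f in monset K E]) => _ _; apply.
by apply: ideal_span_subset; exists 'X_[rpart t]; rewrite ?embrX //; apply/monsetX.
Qed.

Lemma ideal_add_monset N (F G : set 'X_{1..N}) : upset F -> upset G ->
  ideal_add (monset K F) (monset K G) = monset K (F `|` G).
Proof.
move=> upF upG; apply: ideal_span_monset.
- by move=> s t [Fs|Gs]; [left; apply: upF | right; apply: upG].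
- by move=> f [Ff|Gf] t tf; [left; apply: Ff | right; apply: Gf].
by move=> t [Ft|Gt]; apply: ideal_span_subset; [left | right]; apply/monsetX.
Qed.

Lemma sum_ext_monset D E : upset D -> upset E ->
  sum_ext (monset K D) (monset K E) =
    monset K (lpart @^-1` D `|` rpart @^-1` E).
Proof.
move=> upD upE; rewrite /sum_ext extl_monset // extr_monset //.
by rewrite ideal_add_monset //; [apply: lpart_up | apply: rpart_up].
Qed.

Lemma prod_ext_monset D E : upset D -> upset E ->
  prod_ext (monset K D) (monset K E) =
    monset K (lpart @^-1` D `&` rpart @^-1` E).
Proof.
move=> upD upE; rewrite /prod_ext extl_monset // extr_monset //.
have [upl upr] := (lpart_up upD, rpart_up upE).
rewrite ideal_mul_monset //; congr (monset K _); apply/seteqP; split=> t.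
  case=> t1 [t2 [Dt1 Et2 ->]]; split; first exact: upl.
  by rewrite addmC; apply: upr.
case=> Dt Et; exists (joinm (lpart t) 0%MM), (joinm 0%MM (rpart t)).
by rewrite /= lpart_joinm rpart_joinm -joinmD addm0 add0m joinmK.
Qed.

Lemma ideal_bigsum_monset (T : Type) (P : set T) N (F : T -> set 'X_{1..N}) :
  (forall x, upset (F x)) ->
  ideal_bigsum P (fun x => monset K (F x)) = monset K (\bigcup_(x in P) F x).
Proof.
move=> upF; apply: ideal_span_monset.
- by move=> s t [x Px Fs]; exists x => //; apply: upF.
- by move=> f [x Px Ff] t tf; exists x => //; apply: Ff.
by move=> t [x Px Ft]; apply: ideal_span_subset; exists x => //; apply/monsetX.
Qed.

End Extension.

(** * The filtration by integral closures of powers *)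

Lemma nonzero_monset (K : fieldType) n (D : set 'X_{1..n}) :
  monset K D <> [set 0] -> exists s, D s.
Proof.
move=> D0; apply: contrapT => /forallNP noD; apply: D0.
apply/seteqP; split=> f; last by move=> -> t; rewrite msupp0.
by move=> Df; have [//|/mlead_supp/Df/noD] := eqVneq f 0.
Qed.

Section ClosFiltration.
Variables (n : nat) (D : set 'X_{1..n}).
Hypothesis neD : exists s, D s.

Lemma clos_upow0 : clos (upow D 0) = setT.
Proof. by apply/seteqP; split=> // s _; apply: clos_sub. Qed.

Lemma clos_upow_dec i j : (i <= j)%N -> clos (upow D j) `<=` clos (upow D i).
Proof. by move=> /upow_subset sub; apply/clos_subset/sub. Qed.

(** Primality turns [i.+1 g] in [H], which holds as it is in the closure of the
[i.+1]-st power, into [g] in [H], so that [u + g] lies in this closure for each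
[g] in [D]. *)
Lemma clos_upow_cancel H i u : prime_upset H ->
  mcolon (clos (upow D i.+1)) u = H -> clos (upow D i) u.
Proof.
move=> [_ H0 Hprime] uH; apply: clos_cancel => // g Dg.
suff : H g by rewrite -uH.
have Hmul k : H (g *+ k)%MM -> H g.
  by elim: k => [//|k IH]; rewrite mulmS => /Hprime[|/IH].
apply: (Hmul i.+1); rewrite -uH /mcolon /= addmC; apply: clos_up.
apply: clos_sub.
by have := upow_muln i.+1 (upow1 Dg); rewrite mul1n.
Qed.

Lemma integral_closure_pow_monset (K : fieldType) i : upset D ->
  integral_closure (ideal_pow (monset K D) i) = monset K (clos (upow D i)).
Proof.
move=> upD; rewrite ideal_pow_monset // integral_closure_monset //.
  exact: upow_up.
exact: upow_nonempty.
Qed.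

End ClosFiltration.

(** * The local v-number of the integral closure of a power of a sum *)

Theorem corollary2p7 (K : fieldType) (n m k : nat)
    (I : set {mpoly K[n]}) (J : set {mpoly K[m]})
    (p : set {mpoly K[n]}) (q : set {mpoly K[m]}) :
  (1 <= k)%N ->
  is_monomial_ideal I -> I <> setT -> I <> [set 0] ->
  is_monomial_ideal J -> J <> setT -> J <> [set 0] ->
  integral_closure (ideal_pow (sum_ext I J) k) =
    ideal_bigsum [set ij : nat * nat | (ij.1 + ij.2)%N = k]
      (fun ij => prod_ext (integral_closure (ideal_pow I ij.1))
                          (integral_closure (ideal_pow J ij.2))) ->
  is_monomial_prime p -> is_monomial_prime q ->
  Ass (integral_closure (ideal_pow (sum_ext I J) k)) (sum_ext p q) ->
  is_min
    [set (vnumber p (integral_closure (ideal_pow I (k - d)%N)) +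
          vnumber q (integral_closure (ideal_pow J d.+1)))%N
      | d in [set d : nat |
          [/\ (d < k)%N,
              Ass (integral_closure (ideal_pow I (k - d)%N)) p
            & Ass (integral_closure (ideal_pow J d.+1)) q]]]
    (vnumber (sum_ext p q) (integral_closure (ideal_pow (sum_ext I J) k))).
Proof.
move=> _ /monomial_idealE[D upD ->] _ /nonzero_monset neD.
move=> /monomial_idealE[E upE ->] _ /nonzero_monset neE -> {I J}.
move=> /monomial_prime[Hp [-> primeHp Hp_prime]].
move=> /monomial_prime[Hq [-> primeHq Hq_prime]] {p q}.
pose A i := clos (upow D i); pose B j := clos (upow E j).
have upA i : upset (A i) by apply: clos_up.
have upB j : upset (B j) by apply: clos_up.
have AE i : integral_closure (ideal_pow (monset K D) i) = monset K (A i).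
  exact: integral_closure_pow_monset.
have BE j : integral_closure (ideal_pow (monset K E) j) = monset K (B j).
  exact: integral_closure_pow_monset.
have [[upHp Hp0 _] [upHq Hq0 _]] := (primeHp, primeHq).
rewrite sum_ext_monset //; set Hpq := _ `|` _.
have upHpq : upset Hpq.
  by move=> s t [Hs|Hs]; [left; apply: lpart_up Hs | right; apply: rpart_up Hs].
pose L : set 'X_{1..n + m} := [set t | pair_level k A B (lpart t) (rpart t)].
have upL : upset L.
  move=> s t [i [j [ijk As Bs]]]; exists i, j.
  by rewrite lpartD rpartD; split=> //; [apply: upA | apply: upB].
have -> : ideal_bigsum [set ij : nat * nat | (ij.1 + ij.2)%N = k]
    (fun ij => prod_ext (integral_closure (ideal_pow (monset K D) ij.1))
                        (integral_closure (ideal_pow (monset K E) ij.2))) =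
    monset K L.
  have -> : (fun ij : nat * nat =>
      prod_ext (integral_closure (ideal_pow (monset K D) ij.1))
               (integral_closure (ideal_pow (monset K E) ij.2))) =
      (fun ij => monset K (@lpart n m @^-1` A ij.1 `&` @rpart n m @^-1` B ij.2)).
    by apply/funext => ij; rewrite AE BE prod_ext_monset.
  rewrite ideal_bigsum_monset; last first.
    move=> ij s t [As Bs].
    by split; [apply: lpart_up As | apply: rpart_up Bs].
  congr (monset K _); apply/seteqP; split=> t.
    by case=> -[i j] /= ijk [At Bt]; exists i, j.
  by case=> i [j [ijk At Bt]]; exists (i, j).
move=> ass; have [Hpq_prime _] := ass.
have primeHpq := prime_monset upHpq Hpq_prime.
have assL := (Ass_monset upL primeHpq Hpq_prime).1 ass.
have mcolonL w : mcolon L w = Hpq <->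
    forall s r, pair_level k A B (lpart w + s)%MM (rpart w + r)%MM <-> Hp s \/ Hq r.
  split=> [wH s r|wH].
    have : mcolon L w (joinm s r) <-> Hpq (joinm s r) by rewrite wH.
    by rewrite /mcolon /L /Hpq /= lpartD rpartD !lpart_joinm !rpart_joinm.
  apply/seteqP; split=> t; rewrite /mcolon /L /Hpq /= lpartD rpartD => /wH //.
have A0 : A 0%N = setT by apply: clos_upow0.
have B0 : B 0%N = setT by apply: clos_upow0.
have decA i j : (i <= j)%N -> A j `<=` A i by apply: clos_upow_dec.
have decB i j : (i <= j)%N -> B j `<=` B i by apply: clos_upow_dec.
have cancelA i u : mcolon (A i.+1) u = Hp -> A i u by apply: clos_upow_cancel.
have cancelB j v : mcolon (B j.+1) v = Hq -> B j v by apply: clos_upow_cancel.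
(* w is a monomial of least degree with colon p + q *)
have [[w [wH wdeg]] Lmin] := vnumber_monset K upL primeHpq assL.
have upper d : (d < k)%N -> Ass (monset K (A (k - d)%N)) (monset K Hp) ->
    Ass (monset K (B d.+1)) (monset K Hq) ->
    (vnumber (monset K Hpq) (monset K L) <=
      vnumber (monset K Hp) (monset K (A (k - d)%N)) +
      vnumber (monset K Hq) (monset K (B d.+1)))%N.
  move=> dk /(Ass_monset (upA _) primeHp Hp_prime) assA.
  move=> /(Ass_monset (upB _) primeHq Hq_prime) assB.
  have [[u [uH <-]] _] := vnumber_monset K (upA _) primeHp assA.
  have [[v [vH <-]] _] := vnumber_monset K (upB _) primeHq assB.
  apply: Lmin; exists (joinm u v).
    apply/mcolonL; rewrite lpart_joinm rpart_joinm.
    exact: (mcolon_pair upA upB decA decB cancelA cancelB dk uH vH).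
  by rewrite mdeg_split lpart_joinm rpart_joinm.
split; last first.
  by move=> e [d [dk]]; rewrite AE BE => assA assB <-; apply: upper.
have /mcolonL/(mcolon_unpair A0 B0 decA decB Hp0 Hq0 cancelA)[d [dk uH vH]] := wH.
have assA : exists u, mcolon (A (k - d)%N) u = Hp by exists (lpart w).
have assB : exists v, mcolon (B d.+1) v = Hq by exists (rpart w).
have AssA := (Ass_monset (upA _) primeHp Hp_prime).2 assA.
have AssB := (Ass_monset (upB _) primeHq Hq_prime).2 assB.
exists d; first by split; rewrite ?AE ?BE.
rewrite AE BE; apply/eqP; rewrite eqn_leq upper // andbT.
rewrite -wdeg mdeg_split; apply: leq_add.
  have [_] := vnumber_monset K (upA _) primeHp assA.
  by apply; exists (lpart w).
have [_] := vnumber_monset K (upB _) primeHq assB.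
by apply; exists (rpart w).
Qed.
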